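(* Let $t_0<t_n$ be real numbers. Suppose that the index of prices $\mathrm{CPI}$ is an integrable function of time which is differentiable almost everywhere, that $X$ is the corresponding objective function (real value of a unit of money), and that the rate of inflation per unity of time $\iota(t)$ is an integrable function of $t$. Then the rate of inflation $\iota(\langle t_0,t_n\rangle)$ per the time interval $\langle t_0,t_n\rangle$ satisfies $$\iota(\langle t_0,t_n\rangle)=\frac{X(t_0)}{X(t_n)}-1=\exp\left(\int_{t_0}^{t_n}\ln\bigl(1+\iota(u)\bigr)\,du\right)-1 .$$ Moreover, the equation $$\frac{X(t_0)}{X(t_n)}=\prod_{i=0}^{n-1}(I_i+1)^{\,t_{i+1}-t_i}$$ is the special case of the previous one for a piecewise constant function $\iota$, where $t_0<t_1<\dots<t_n$ and $\iota$ has the constant value $I_i$ on the open interval $(t_i,t_{i+1})$ for each $i=0,\dots,n-1$.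
   Context: $\langle a,b\rangle$ denotes the closed interval $[a,b]$. The index of prices is a positive function $\mathrm{CPI}$ of time. The objective function $X$ (the real value of a unit of money) is the reciprocal of $\mathrm{CPI}$ up to a suitable rescaling: $X(t)=c/\mathrm{CPI}(t)$ for some constant $c>0$. The rate of inflation per the time interval $\langle a,b\rangle$, denoted $\iota(\langle a,b\rangle)$, is defined by $$1+\iota(\langle a,b\rangle)=\frac{\mathrm{CPI}(b)}{\mathrm{CPI}(a)}=\frac{X(a)}{X(b)}.$$ The inflation is assumed to depend differentiably on time almost everywhere. The rate of inflation per unity of time at time $t$, denoted $\iota(t)$, is defined at almost every $t$ (where $\mathrm{CPI}$ is differentiable) by $$\iota(t)=\exp\left(\frac{\mathrm{CPI}'(t)}{\mathrm{CPI}(t)}\right)-1 ,$$ and at the remaining points it can be defined by one-sided limits. Equivalently, where $\mathrm{CPI}$ is differentiable, $\iota(t)=F(t+1)/F(t)-1$ for the exponential function $F(x)=Ae^{Bx}$ having the same value and the same first derivative as $\mathrm{CPI}$ at the point $t$ (the rate of the constant inflation having first order contact with the given inflation at $t$).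
   Formalization: The index of prices CPI is additionally assumed to be absolutely continuous on the interval from t_0 to t_n; without this the formula fails, e.g. for a CPI that jumps from 1 to 2 and is otherwise constant (rate of inflation 0 almost everywhere). *)

(* Defs.v *)
From mathcomp Require Import all_boot all_order all_algebra.
From mathcomp Require Import all_classical all_reals all_analysis.

Set Implicit Arguments.
Unset Strict Implicit.
Unset Printing Implicit Defensive.

Import Order.TTheory GRing.Theory Num.Theory.
Import numFieldNormedType.Exports.

Local Open Scope classical_set_scope.
Local Open Scope ring_scope.

Definition objective_function (R : realType) (D : set R) (CPI X : R -> R) :=
  exists2 c : R, 0 < c & forall t, D t -> X t = c / CPI t.

Definition interval_inflation (R : realType) (CPI : R -> R) (a b : R) : R :=
  CPI b / CPI a - 1.

(* The values of [infl] where [CPI] is not differentiable are left arbitrary;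
   this covers any choice there, in particular one-sided limits. *)
Definition inflation_rate (R : realType) (D : set R) (CPI infl : R -> R) :=
  forall t, D t -> derivable CPI t 1 ->
    infl t = expR (derive1 CPI t / CPI t) - 1.

(* Some hypothesis of this kind is needed: a step function, or the Cantor
   function plus 1, has derivative 0 almost everywhere, hence inflation rate 0
   almost everywhere, without being constant.  A function is the integral of
   its derivative on every subinterval of [a, b] exactly when it is absolutely
   continuous there.  Empty intervals are allowed and contribute nothing. *)
Definition absolutely_continuous (R : realType) (a b : R) (f : R -> R) :=
  forall e : R, 0 < e -> exists2 d : R, 0 < d &
    forall (n : nat) (l r : 'I_n -> R),
      (forall i, a <= l i /\ l i <= r i /\ r i <= b) ->
      trivIset setT (fun i => `]l i, r i[%classic) ->
      \sum_(i < n) (r i - l i) < d ->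
      \sum_(i < n) `|f (r i) - f (l i)| < e.

Definition subdivision (R : realType) (a b : R) (n : nat) (s : nat -> R) :=
  [/\ s 0%N = a, s n = b & forall i, (i < n)%N -> s i < s i.+1].

Definition piecewise_constant (R : realType) (n : nat) (s I : nat -> R)
    (g : R -> R) :=
  forall i, (i < n)%N -> forall u, s i < u < s i.+1 -> g u = I i.

(* Main.v *)
Require Import Defs.
From mathcomp Require Import all_boot all_order all_algebra.
From mathcomp Require Import all_classical all_reals all_analysis.
From mathcomp Require Import measurable_realfun.
From mathcomp Require Import ring lra.

Set Implicit Arguments.
Unset Strict Implicit.
Unset Printing Implicit Defensive.

Import Order.TTheory GRing.Theory Num.Theory.
Import numFieldNormedType.Exports.

Local Open Scope classical_set_scope.
Local Open Scope ring_scope.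

(** By definition of the rate, 1 + infl t = exp (CPI' t / CPI t) wherever CPI
    is differentiable, so ln (1 + infl) is almost everywhere the derivative of
    f = ln o CPI. The function f is absolutely continuous, because CPI is and
    because ln is Lipschitz on the values of CPI, which are bounded away from 0.
    The fundamental theorem of calculus for absolutely continuous functions
    ([absolutely_continuous_FTC]) then gives that ln (1 + infl) is integrable
    with integral f tn - f t0 = ln (CPI tn / CPI t0) = ln (X t0 / X tn);
    taking exponentials yields the formula, and the integral of a step
    function turns it into the product.

    The fundamental theorem is proved for a function f that is absolutely
    continuous and has derivative g almost everywhere, by approximating g with
    the slopes of f on the cells of uniform meshes. These step functions
    converge to g almost everywhere ([cvg_difference_quotient]), their
    integrals telescope to f b - f a ([sum_slope]), and they are uniformly
    integrable, directly by absolute continuity ([slope_equiintegrable]).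
    Passing to the limit is thus an instance of Vitali's convergence theorem;
    it is carried out by truncating the slopes, using dominated convergence
    for the truncated functions ([cvg_slope_integral]) and then letting the
    truncation level grow ([integrable_derivative], [integral_derivative]). *)

(** * Integrals over intervals *)

Lemma integral_open_closed (R : realType) (x y : R) (g : R -> R) :
  (@lebesgue_measure R).-integrable `]x, y[ (EFin \o g) ->
  (@lebesgue_measure R).-integrable `[x, y] (EFin \o g) /\
  \int[@lebesgue_measure R]_(u in `[x, y]) g u =
  \int[@lebesgue_measure R]_(u in `]x, y[) g u.
Proof.
move=> ig; have mg := measurable_int _ ig.
have mg' : measurable_fun `[x, y] g.
  apply/measurable_fun_itv_bndo_bndcP/measurable_fun_itv_obnd_cbndP.
  exact/measurable_EFinP.
split; last by rewrite /Rintegral integral_itv_bndoo.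
apply/integrableP; split; first exact/measurable_EFinP.
rewrite integral_itv_bndoo//; last exact: measurableT_comp.
by case/integrableP : ig.
Qed.

Lemma integral_cst_on_open (R : realType) (x y c : R) (g : R -> R) :
  x <= y -> (forall u, x < u < y -> g u = c) ->
  (@lebesgue_measure R).-integrable `[x, y] (EFin \o g) /\
  \int[@lebesgue_measure R]_(u in `[x, y]) g u = c * (y - x).
Proof.
move=> lexy gc.
have muxy : lebesgue_measure (`]x, y[%classic : set R) = (y - x)%:E.
  rewrite lebesgue_measure_itv/= lte_fin; case: ltgtP lexy => // -> _.
  by rewrite subrr.
have gcE u : u \in (`]x, y[%classic : set R) -> g u = c.
  by rewrite inE /= in_itv/= => /gc.
have ig : (@lebesgue_measure R).-integrable `]x, y[ (EFin \o g).
  apply: (@eq_integrable _ _ _ _ _ _ (EFin \o cst c)) => //.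
    by move=> u /gcE /= ->.
  apply: measurable_bounded_integrable => //.
    by rewrite [ltLHS]muxy ltry.
  exists `|c|; split; first exact: num_real.
  by move=> M cM u _; exact: ltW.
have [ig' ->] := integral_open_closed ig; split=> //.
rewrite (@eq_Rintegral _ _ _ _ _ (cst c))//.
by rewrite Rintegral_cst// [X in fine X]muxy.
Qed.

Lemma integrableU d (T : measurableType d) (R : realType)
    (mu : {measure set T -> \bar R}) (A B : set T) (f : T -> \bar R) :
  measurable A -> measurable B -> [disjoint A & B] ->
  mu.-integrable A f -> mu.-integrable B f -> mu.-integrable (A `|` B) f.
Proof.
move=> mA mB AB /integrableP[mfA iA] /integrableP[mfB iB].
have mf : measurable_fun (A `|` B) f by exact/measurable_funU.
apply/integrableP; split=> //.
rewrite ge0_integral_setU//; last exact: measurableT_comp.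
exact: lte_add_pinfty.
Qed.

(** Nodes form a null set, so the values on the open cells determine the
    integral.  Both the approximating step functions and the piecewise constant
    inflation rate of the final formula are integrated with this lemma. *)
Lemma integral_step (R : realType) (n : nat) (s c : nat -> R) (g : R -> R) :
  (forall i, (i < n)%N -> s i <= s i.+1) ->
  (forall i, (i < n)%N -> forall u, s i < u < s i.+1 -> g u = c i) ->
  (@lebesgue_measure R).-integrable `[s 0%N, s n] (EFin \o g) /\
  \int[@lebesgue_measure R]_(u in `[s 0%N, s n]) g u =
    \sum_(i < n) c i * (s i.+1 - s i).
Proof.
elim: n => [_ _|n IHn sS gc].
  rewrite big_ord0 set_itv1 Rintegral_set1; split=> //.
  rewrite -set_itv1.
  have [u|] // := @integral_cst_on_open _ (s 0%N) (s 0%N) 0 g (lexx _).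
  by rewrite lt_asym.
have [|i lin|ign intn] := IHn.
- by move=> i lin; apply: sS; rewrite ltnW.
- by apply: gc; rewrite ltnW.
have [ig1 int1] := integral_cst_on_open (sS n (leqnn _)) (gc n (leqnn _)).
have s0n : s 0%N <= s n.
  have : forall k, (k <= n)%N -> s 0%N <= s k.
    elim=> // k IHk kn; apply: (le_trans (IHk (ltnW kn))).
    by apply: sS; rewrite ltnW.
  exact.
have snS := sS n (leqnn _).
have ig : (@lebesgue_measure R).-integrable `[s 0%N, s n.+1] (EFin \o g).
  rewrite (@itv_bndbnd_setU _ _ _ (BLeft (s n))) ?bnd_simp//.
  apply: integrableU => //.
  - apply/disj_setPS => u [/=]; rewrite !in_itv/= => /andP[_ un] /andP[].
    by rewrite leNgt un.
  - by apply: integrableS ign => //; apply: subset_itvl; rewrite bnd_simp.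
split=> //.
rewrite big_ord_recr/= -intn -int1.
have := @Rintegral_itvB _ g (BLeft (s 0%N)) (BRight (s n.+1)) (s n) ig.
rewrite !bnd_simp/= => /(_ s0n snS).
rewrite Rintegral_itv_obnd_cbnd.
  by move=> <-; rewrite addrC subrK.
apply: integrableS ig1 => //.
by apply: subset_itvr; rewrite bnd_simp.
Qed.

(** * Slopes on uniform meshes *)

(** The mesh has n.+1 cells, so that the step is never divided by 0; its nodes
    are indexed by 0, ..., n.+1. *)
Definition mesh (R : realType) (a b : R) (n i : nat) : R :=
  a + i%:R * ((b - a) / n.+1%:R).

Definition slope (R : realType) (a b : R) (f : R -> R) (n i : nat) : R :=
  (f (mesh a b n i.+1) - f (mesh a b n i)) / ((b - a) / n.+1%:R).

Section mesh.
Variables (R : realType) (a b : R).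
Hypothesis ltab : a < b.

Lemma step_gt0 n : 0 < (b - a) / n.+1%:R.
Proof. by rewrite divr_gt0 ?subr_gt0 ?ltr0n. Qed.

Lemma mesh0 n : mesh a b n 0 = a.
Proof. by rewrite /mesh mul0r addr0. Qed.

Lemma meshN n : mesh a b n n.+1 = b.
Proof. by rewrite /mesh mulrC divfK ?pnatr_eq0// addrC subrK. Qed.

Lemma meshS n i : mesh a b n i.+1 - mesh a b n i = (b - a) / n.+1%:R.
Proof. by rewrite /mesh -natr1; ring. Qed.

Lemma mesh_le n i j : (i <= j)%N -> mesh a b n i <= mesh a b n j.
Proof.
by move=> ij; rewrite lerD2l ler_wpM2r ?ler_nat// ltW// step_gt0.
Qed.

Lemma mesh_itv n i : (i < n.+1)%N ->
  [/\ a <= mesh a b n i, mesh a b n i <= mesh a b n i.+1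
    & mesh a b n i.+1 <= b].
Proof.
move=> lin; split; last 2 first.
- exact: mesh_le.
- by rewrite -[leRHS](meshN n) mesh_le.
- by rewrite -[leLHS](mesh0 n) mesh_le.
Qed.

Lemma step_cvg0 : (b - a) / n.+1%:R @[n --> \oo] --> (0 : R).
Proof.
rewrite -[X in _ --> X](mulr0 (b - a)).
by apply: cvgM; [exact: cvg_cst|exact: cvg_harmonic].
Qed.

End mesh.

Section absolutely_continuous_mesh.
Variables (R : realType) (a b : R) (f : R -> R).
Hypotheses (ltab : a < b) (acf : absolutely_continuous a b f).

(** Absolute continuity read on a mesh.  A cell of length h contributes
    |slope| * h = |increment of f|, so small sets of cells carry small total
    variation. *)
Lemma absolutely_continuous_cells (e : R) : 0 < e -> exists2 d : R, 0 < d &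
  forall n (E : {set 'I_n.+1}), #|E|%:R * ((b - a) / n.+1%:R) < d ->
    \sum_(i in E) `|slope a b f n i| * ((b - a) / n.+1%:R) < e.
Proof.
move=> e0; have [d d0 fd] := acf e0; exists d => // n E Ed.
have h0 := step_gt0 ltab n.
rewrite (eq_bigr (fun i : 'I_n.+1 =>
    `|f (mesh a b n i.+1) - f (mesh a b n i)|)); last first.
  move=> i _; rewrite -[X in _ * X](gtr0_norm h0) -normrM divfK ?gt_eqF//.
rewrite big_enum_val/=.
apply: (fd _ (fun i => mesh a b n (@enum_val _ (pred_of_set E) i))
             (fun i => mesh a b n (@enum_val _ (pred_of_set E) i).+1)).
- by move=> i; have [] := mesh_itv ltab (ltn_ord (enum_val i)).
- apply/trivIsetP => i j _ _ /eqP ij; apply/seteqP; split=> // u [/=].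
  rewrite !in_itv/= => /andP[iu ui] /andP[ju uj].
  have {}ij : enum_val i != enum_val j :> nat.
    by apply: contra_not_neq ij => ij; apply/enum_val_inj/val_inj.
  case: ltngtP ij => // [lij|lji] _.
  + by have := lt_trans ju (lt_le_trans ui (mesh_le ltab n lij)); rewrite ltxx.
  + by have := lt_trans iu (lt_le_trans uj (mesh_le ltab n lji)); rewrite ltxx.
- under eq_bigr do rewrite meshS.
  by rewrite sumr_const card_ord -[X in X < _]mulr_natl.
Qed.

(** Uniform integrability of the step functions with values [slope], which is
    what absolute continuity provides.  Let d answer to e.  If the cells with
    |slope| > K = 2e/d had total length at least d, a maximal subfamily F of
    total length below d would, for a mesh finer than d/2, have length more
    than d/2, hence variation more than K * d/2 = e, against the choice of d. *)
Lemma slope_equiintegrable (e : R) : 0 < e -> exists2 K : R, 0 < K &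
  \forall n \near \oo, \sum_(i < n.+1 | K < `|slope a b f n i|)
     `|slope a b f n i| * ((b - a) / n.+1%:R) <= e.
Proof.
move=> e0; have [d d0 fd] := absolutely_continuous_cells e0.
exists (2 * e / d); first by rewrite divr_gt0 ?mulr_gt0.
have d2 : 0 < d / 2 by rewrite divr_gt0.
have /cvgrPdist_lt/(_ _ d2) := step_cvg0 a b.
apply: filterS => n; rewrite sub0r normrN gtr0_norm ?step_gt0// => hd.
set h := (b - a) / n.+1%:R in hd *; have h0 : 0 < h := step_gt0 ltab n.
pose E := [set i : 'I_n.+1 | 2 * e / d < `|slope a b f n i|]%SET.
rewrite (eq_bigl (mem E)); last by move=> i; rewrite !inE.
pose P := [pred F : {set 'I_n.+1} | (F \subset E) && (#|F|%:R * h < d)].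
have [F /maxsetP[/andP[FE Fd] maxF] _] :
  {F | maxset P F & finset.set0 \subset F}.
  by apply: maxset_exists; rewrite /P/= finset.sub0set cards0 mul0r.
have [->|/eqP EF] := eqVneq E F; first by rewrite ltW// fd.
have /subsetPn[i iE iF] : ~~ (E \subset F).
  by apply/negP => EsubF; apply: EF; apply/eqP; rewrite finset.eqEsubset EsubF.
have dF : d / 2 < #|F|%:R * h.
  have : ~ P (i |: F)%SET.
    move=> /maxF FiF; have := finset.setU11 i F.
    by rewrite FiF ?(negbTE iF)// finset.subsetUr.
  rewrite /P/= finset.subUset finset.sub1set iE FE/= cardsU1 iF => /negP.
  rewrite -leNgt natrD mulrDl mul1r; lra.
have : \sum_(i in F) `|slope a b f n i| * h < e by apply: fd.
have : \sum_(i in F) (2 * e / d) * h <= \sum_(i in F) `|slope a b f n i| * h.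
  apply: ler_sum => j /(fintype.subsetP FE); rewrite inE => jK.
  by rewrite ler_wpM2r ?ltW.
rewrite sumr_const => /le_lt_trans/[apply].
have -> : 2 * e / d * h *+ #|F| = (2 * e / d) * (#|F|%:R * h).
  by rewrite -mulr_natl; ring.
have : 2 * e / d * (d / 2) < 2 * e / d * (#|F|%:R * h).
  by rewrite ltr_pM2l// divr_gt0 ?mulr_gt0.
have -> : 2 * e / d * (d / 2) = e by field; rewrite gt_eqF.
by move=> /lt_trans/[apply]; rewrite ltxx.
Qed.

End absolutely_continuous_mesh.

(** * Convergence of the slopes *)

(** Straddling: the linear approximation errors at [u n] and [v n] are at most
    e * (x - u n) and e * (v n - x), and these add up to e * (v n - u n) because
    x lies between the two points. *)
Lemma cvg_difference_quotient (R : realType) (f : R -> R) (x l : R)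
    (u v : nat -> R) :
  is_derive x 1 f l -> (forall n, u n <= x < v n) ->
  v n - u n @[n --> \oo] --> (0 : R) ->
  (f (v n) - f (u n)) / (v n - u n) @[n --> \oo] --> l.
Proof.
move=> [df fl] uxv vu0; apply/cvgrPdist_le => e e0.
have /cvgrPdist_le/(_ e e0)[d /= d0 dP] :
  h^-1 *: ((f \o shift x) (h *: 1) - f x) @[h --> 0^'] --> l by rewrite -fl.
have linear y : `|y - x| < d -> `|f y - f x - l * (y - x)| <= e * `|y - x|.
  move=> yd; have [->|yx] := eqVneq y x;
    first by rewrite !(subrr, mulr0, normr0).
  have yx0 : y - x != 0 by rewrite subr_eq0.
  have := dP (y - x); rewrite /= sub0r normrN => /(_ yd yx0).
  rewrite [(y - x) *: 1]mulr1 subrK /GRing.scale/= => le_e.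
  have -> : f y - f x - l * (y - x) =
      - ((l - (y - x)^-1 * (f y - f x)) * (y - x)) by field.
  by rewrite normrN normrM ler_wpM2r.
have /cvgrPdist_lt/(_ d d0) := vu0.
apply: filterS => n; have /andP[ux xv] := uxv n.
have uv : 0 < v n - u n by rewrite subr_gt0 (le_lt_trans ux).
rewrite sub0r normrN gtr0_norm// => vud.
have := linear (v n); have := linear (u n).
rewrite [`|u n - x|]distrC (ger0_norm (_ : 0 <= x - u n)) ?subr_ge0//.
rewrite (gtr0_norm (_ : 0 < v n - x)) ?subr_gt0//.
move=> /(_ ltac:(lra)) fu /(_ ltac:(lra)) fv.
rewrite -(ler_pM2r uv) -[X in _ * X <= _](gtr0_norm uv) -normrM.
have -> : (l - (f (v n) - f (u n)) / (v n - u n)) * (v n - u n) =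
    (f (u n) - f x - l * (u n - x)) - (f (v n) - f x - l * (v n - x)).
  by field; rewrite gt_eqF.
apply: (le_trans (ler_normB _ _)); lra.
Qed.

Section derivative_ae.
Variables (R : realType) (a b : R) (f g : R -> R).
Hypotheses (ltab : a < b) (mg : measurable_fun `]a, b[ g).
Hypothesis df : {ae (@lebesgue_measure R),
  forall x, a < x < b -> is_derive x 1 f (g x)}.

Local Notation mu := (@lebesgue_measure R).

Let cell n x : nat := Num.truncn ((x - a) / ((b - a) / n.+1%:R)).

Let cell_bounds n x : a <= x ->
  mesh a b n (cell n x) <= x < mesh a b n (cell n x).+1.
Proof.
move=> ax; have h0 := step_gt0 ltab n.
have : 0 <= (x - a) / ((b - a) / n.+1%:R).
  by rewrite divr_ge0 ?subr_ge0// ltW.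
move=> /truncn_itv /andP[]; rewrite ler_pdivlMr// ltr_pdivrMr//.
by rewrite lerBrDl ltrBlDl => -> ->.
Qed.

Let cellE n i x : mesh a b n i < x < mesh a b n i.+1 -> cell n x = i.
Proof.
move=> /andP[ix xi]; have h0 := step_gt0 ltab n.
apply: truncn_def; rewrite ler_pdivlMr// ltr_pdivrMr//.
by rewrite lerBrDl ltrBlDl xi ltW.
Qed.

Let cvg_slope_cell x : a < x -> is_derive x 1 f (g x) ->
  slope a b f n (cell n x) @[n --> \oo] --> g x.
Proof.
move=> ax dfx.
pose u n := mesh a b n (cell n x); pose v n := mesh a b n (cell n x).+1.
have uv n : v n - u n = (b - a) / n.+1%:R by exact: meshS.
have -> : (fun n => slope a b f n (cell n x)) =
    (fun n => (f (v n) - f (u n)) / (v n - u n)).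
  by apply/funext => n; rewrite uv.
apply: cvg_difference_quotient => // [n|].
  exact/cell_bounds/ltW.
by under eq_fun do rewrite uv; exact: step_cvg0.
Qed.

(** The step function [slope] of the cell containing x tends to g x at almost
    every x; composing with a bounded phi makes dominated convergence
    applicable even though g is not yet known to be integrable. *)
Lemma cvg_slope_integral (phi : R -> R) (M : R) :
  continuous phi -> (forall y, `|phi y| <= M) ->
  mu.-integrable `]a, b[ (EFin \o (phi \o g)) /\
  \sum_(i < n.+1) phi (slope a b f n i) * ((b - a) / n.+1%:R) @[n --> \oo]
    --> \int[mu]_(x in `]a, b[) phi (g x).
Proof.
move=> cphi phiM.
pose G n x := phi (slope a b f n (cell n x)).
have [iG intG] : (forall n, mu.-integrable `]a, b[ (EFin \o G n)) /\
    forall n, \int[mu]_(x in `]a, b[) G n x =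
      \sum_(i < n.+1) phi (slope a b f n i) * ((b - a) / n.+1%:R).
  apply/all_and2 => n.
  have [i lin|i lin u|] := @integral_step R n.+1 (mesh a b n)
    (fun i => phi (slope a b f n i)) (G n).
  - by have [] := mesh_itv ltab lin.
  - by move=> /cellE; rewrite /G => ->.
  rewrite mesh0 meshN => iG intG.
  have iGo : mu.-integrable `]a, b[ (EFin \o G n).
    apply: integrableS iG => //.
    by apply: subset_itv; rewrite bnd_simp.
  split=> //; have [_ <-] := integral_open_closed iGo.
  by rewrite intG; apply: eq_bigr => i _; rewrite meshS.
have mphig : measurable_fun `]a, b[ (phi \o g).
  by apply: measurableT_comp => //; exact: continuous_measurable_fun.
have [||||||iphig _ cvgi] := @dominated_convergence _ _ _ mu `]a, b[%classic _
  (fun n => EFin \o G n) (EFin \o (phi \o g)) (EFin \o cst M).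
- by [].
- by move=> n; exact: measurable_int (iG n).
- exact/measurable_EFinP.
- move: df; apply: (@filterS _ _ (ae_filter_ringOfSetsType mu)) => x dfx.
  rewrite /= in_itv/= => axb.
  apply: cvg_EFin; first exact: nearW.
  have /andP[ax _] := axb.
  exact: continuous_cvg (cphi _) (cvg_slope_cell ax (dfx axb)).
- apply: measurable_bounded_integrable => //.
    by rewrite [ltLHS]lebesgue_measure_itv/=; case: ifP => _; rewrite ?ltry.
  exists `|M|; split; first exact: num_real.
  by move=> N MN x _; exact: ltW.
- by apply: aeW => x n _ /=; rewrite lee_fin phiM.
split=> //.
under eq_fun do rewrite -intG.
apply: fine_cvg; rewrite fineK//.
exact: integrable_fin_num.
Qed.
End derivative_ae.

(** * Truncations and the fundamental theorem of calculus *)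

Lemma sum_slope (R : realType) (a b : R) (f : R -> R) n : a < b ->
  \sum_(i < n.+1) slope a b f n i * ((b - a) / n.+1%:R) = f b - f a.
Proof.
move=> ltab.
have -> : f b - f a = f (mesh a b n n.+1) - f (mesh a b n 0).
  by rewrite meshN mesh0.
rewrite -(telescope_sumr (fun i => f (mesh a b n i)))// big_mkord.
by apply: eq_bigr => i _; rewrite divfK ?gt_eqF ?step_gt0.
Qed.

Section truncation.
Variables (R : realType) (k : R).
Hypothesis k0 : 0 <= k.

Definition clamp (y : R) : R := Num.max (- k) (Num.min k y).

Lemma continuous_min_norm : continuous (fun y : R => Num.min k `|y|).
Proof.
move=> y; apply: (@continuous_min _ _ (cst k) (fun y : R => `|y|)).
  exact: cvg_cst.
exact: norm_continuous.
Qed.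

Lemma continuous_clamp : continuous clamp.
Proof.
move=> y; apply: (@continuous_max _ _ (cst (- k)) (fun y => Num.min k y)).
  exact: cvg_cst.
by apply: (@continuous_min _ _ (cst k) id) => //; exact: cvg_cst.
Qed.

Lemma clamp_bound y : `|clamp y| <= k.
Proof.
rewrite ler_norml /clamp le_max lexx/= ge_max ge_min lexx /=.
by rewrite andbT (le_trans _ k0)// oppr_le0.
Qed.

Lemma clamp_le y : `|clamp y| <= `|y|.
Proof.
have := normr_ge0 y; have := ler_norm y; have := ler_norm (- y); have := k0.
rewrite normrN ler_norml /clamp le_max ge_max le_min ge_min
  => k_ge0 Ny_le y_le y0.
by apply/andP; split; [apply/orP; right|]; apply/andP; split=> //;
  rewrite ?y_le ?orbT//; lra.
Qed.

Lemma clamp_id y : `|y| <= k -> clamp y = y.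
Proof.
rewrite ler_norml => /andP[ky yk]; rewrite /clamp (min_idPr yk).
exact/max_idPr.
Qed.

Lemma clamp_dist y : `|y - clamp y| <= if k < `|y| then `|y| else 0.
Proof.
case: ltP => [ky|/clamp_id->]; last by rewrite subrr normr0.
rewrite /clamp; have [y0|y0] := lerP 0 y.
  rewrite (ger0_norm y0) in ky *.
  rewrite (min_idPl (ltW ky)) (max_idPr _) ?ger0_norm; have := k0; lra.
rewrite (ltr0_norm y0) in ky *.
rewrite (min_idPr _) ?(max_idPl _) ?ler0_norm; have := k0; lra.
Qed.
End truncation.

Section FTC.
Variables (R : realType) (a b : R) (f g : R -> R).
Hypotheses (ltab : a < b) (acf : absolutely_continuous a b f).
Hypothesis mg : measurable_fun `]a, b[ g.
Hypothesis df : {ae (@lebesgue_measure R),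
  forall x, a < x < b -> is_derive x 1 f (g x)}.

Local Notation mu := (@lebesgue_measure R).
Local Notation h n := ((b - a) / n.+1%:R).

(** The truncations min(k, |g|) have integrals bounded independently of k: in
    the approximating sums, cells with |slope| <= K contribute at most
    K * (b - a) and the others at most 1 by uniform integrability.  Monotone
    convergence in k concludes. *)
Lemma integrable_derivative : mu.-integrable `]a, b[ (EFin \o g).
Proof.
have [K K0 fK] := slope_equiintegrable ltab acf ltr01.
have trunc k : 0 <= k ->
   mu.-integrable `]a, b[ (EFin \o (fun x => Num.min k `|g x|)) /\
   \int[mu]_(x in `]a, b[) Num.min k `|g x| <= K * (b - a) + 1.
  move=> k0.
  have [//|//|y|iphi cvgi] := @cvg_slope_integral R a b f g ltab _ _
    (fun y => Num.min k `|y|) k (@continuous_min_norm _ k).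
    by rewrite ger0_norm ?ge_min ?lexx// le_min k0 /=.
  split=> //; apply: (cvgr_to_le cvgi); apply: filterS fK => n fKn.
  apply: le_trans (lerD (lexx (K * (b - a))) fKn).
  have -> : K * (b - a) = \sum_(i < n.+1) K * h n.
    by rewrite sumr_const card_ord -mulr_natl; field.
  rewrite [X in _ <= _ + X]big_mkcond/= -big_split/=; apply: ler_sum => i _.
  have h0 := step_gt0 ltab n.
  case: ltP => hK; last by rewrite addr0 ler_pM2r// ge_min hK orbT.
  rewrite -mulrDl ler_pM2r// ge_min; apply/orP; right; lra.
have mming n : measurable_fun `]a, b[ (fun x => (Num.min n%:R `|g x|)%:E).
  by have [i _] := trunc n%:R (ler0n _ _); exact: measurable_int i.
apply/integrableP; split; first exact/measurable_EFinP.
have := @cvg_monotone_convergence _ _ _ mu `]a, b[%classic _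
  (fun n x => (Num.min n%:R `|g x|)%:E) mming.
have lim x : lim ((Num.min n%:R `|g x|)%:E @[n --> \oo]) = `|g x|%:E.
  apply: cvg_lim => //; apply: cvg_EFin; first exact: nearW.
  apply: cvg_near_cst; apply: filterS (nbhs_infty_ger `|g x|) => n gn /=.
  exact/min_idPr.
under eq_integral do rewrite lim.
move=> cvgm; apply: (@le_lt_trans _ _ (K * (b - a) + 1)%:E); last exact: ltry.
apply: (cvge_to_le (cvgm _ _ _)).
- by [].
- by move=> n x _; rewrite lee_fin le_min ler0n /=.
- move=> x _ m n mn; by rewrite lee_fin le_min !ge_min lexx orbT ler_nat mn.
apply: nearW => n.
have [im lem] := trunc n%:R (ler0n _ _).
by rewrite -lee_fin /Rintegral fineK// in lem; exact: integrable_fin_num.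
Qed.

(** Without truncation the sums of [slope] telescope to f b - f a.  Clamping the
    slopes between -k and k changes the sums by at most the contribution of the
    cells with |slope| > k, which is uniformly small; so the integrals of the
    clamped g tend to f b - f a as k grows, and they also tend to the integral of g. *)
Lemma integral_derivative : \int[mu]_(x in `]a, b[) g x = f b - f a.
Proof.
have ig := integrable_derivative.
have trunc k : 0 <= k ->
  mu.-integrable `]a, b[ (EFin \o (fun x => clamp k (g x))) /\
  \sum_(i < n.+1) clamp k (slope a b f n i) * h n @[n --> \oo]
    --> \int[mu]_(x in `]a, b[) clamp k (g x).
  move=> k0; apply: (@cvg_slope_integral R a b f g ltab _ _ (clamp k) k) => //.
    exact: continuous_clamp.
  exact: clamp_bound.
have cvg_value :
    \int[mu]_(x in `]a, b[) clamp n%:R (g x) @[n --> \oo] --> f b - f a.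
  apply/cvgrPdist_le => e e0.
  have [K K0 fK] := slope_equiintegrable ltab acf e0.
  apply: filterS (nbhs_infty_ger K) => k Kk.
  have [_ cvgi] := trunc k%:R (ler0n _ _).
  have cvgd :
      `|f b - f a - \sum_(i < n.+1) clamp k%:R (slope a b f n i) * h n|
        @[n --> \oo]
      --> `|f b - f a - \int[mu]_(x in `]a, b[) clamp k%:R (g x)|.
    by apply: cvg_norm; apply: cvgB => //; exact: cvg_cst.
  apply: (cvgr_to_le cvgd); apply: filterS fK => n; apply: le_trans.
  rewrite -(sum_slope f n ltab) -sumrB [leRHS]big_mkcond/=.
  apply: (le_trans (ler_norm_sum _ _ _)); apply: ler_sum => i _.
  have h0 := step_gt0 ltab n.
  rewrite -mulrBl normrM (gtr0_norm h0).
  have dist_le := clamp_dist (ler0n _ k) (slope a b f n i).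
  apply: (le_trans (ler_wpM2r (ltW h0) dist_le)).
  case: ifP => ks; first by rewrite (le_lt_trans Kk ks).
  by rewrite mul0r; case: ifP => // _; rewrite mulr_ge0// ltW.
have cvg_int : \int[mu]_(x in `]a, b[) clamp n%:R (g x) @[n --> \oo]
    --> \int[mu]_(x in `]a, b[) g x.
  have [||||||_ _ cvgi] := @dominated_convergence _ _ _ mu `]a, b[%classic _
    (fun n => EFin \o (fun x => clamp n%:R (g x))) (EFin \o g)
    (EFin \o (fun x => `|g x|)).
  - by [].
  - by move=> n; have [] := trunc n%:R (ler0n _ _) => /measurable_int.
  - exact/measurable_EFinP.
  - apply: aeW => x _; apply: cvg_EFin; first exact: nearW.
    apply: cvg_near_cst; apply: filterS (nbhs_infty_ger `|g x|) => n gn /=.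
    exact: clamp_id.
  - exact: integrable_norm.
  - by apply: aeW => x n _ /=; rewrite lee_fin clamp_le.
  apply: fine_cvg; rewrite fineK//.
  exact: integrable_fin_num.
exact: cvg_unique cvg_int cvg_value.
Qed.
End FTC.

Lemma absolutely_continuous_FTC (R : realType) (a b : R) (f g : R -> R) :
  a < b -> absolutely_continuous a b f -> measurable_fun `]a, b[ g ->
  {ae (@lebesgue_measure R), forall x, a < x < b -> is_derive x 1 f (g x)} ->
  (@lebesgue_measure R).-integrable `[a, b] (EFin \o g) /\
  \int[@lebesgue_measure R]_(x in `[a, b]) g x = f b - f a.
Proof.
move=> ab acf mg df.
have [ig ->] := integral_open_closed (integrable_derivative ab acf mg df).
by split=> //; exact: integral_derivative.
Qed.

(** * Absolute continuity of the logarithm of a function *)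

Lemma absolutely_continuous_continuous (R : realType) (a b : R) (f : R -> R) :
  absolutely_continuous a b f -> {within `[a, b], continuous f}.
Proof.
move=> acf; apply/subspace_continuousP => x /=.
rewrite in_itv/= => /andP[ax xb].
apply/cvgrPdist_lt => e /acf[d d0 fd].
have close l r : a <= l -> l <= r -> r <= b -> r - l < d -> `|f r - f l| < e.
  move=> al lr rb lrd; have := fd 1%N (fun=> l) (fun=> r).
  rewrite !big_ord1; apply => //; apply/trivIsetP => i j _ _.
  by rewrite !ord1 eqxx.
rewrite near_withinE; near=> y => /=; rewrite in_itv/= => /andP[ay yb].
have : `|x - y| < d by near: y; exact: cvgr_dist_lt.
have [xy|/ltW yx] := leP x y => xyd; last first.
  by apply: close; rewrite // -(ger0_norm (_ : 0 <= x - y)) ?subr_ge0.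
rewrite distrC; apply: close => //.
by rewrite -(ger0_norm (_ : 0 <= y - x)) ?subr_ge0// distrC.
Unshelve. all: by end_near. Qed.

Lemma absolutely_continuous_lipschitz_comp (R : realType) (a b k : R)
    (f phi : R -> R) : 0 < k ->
  (forall x y, a <= x <= b -> a <= y <= b ->
    `|phi (f x) - phi (f y)| <= k * `|f x - f y|) ->
  absolutely_continuous a b f -> absolutely_continuous a b (phi \o f).
Proof.
move=> k0 lip acf e e0; have [d d0 fd] := acf (e / k) (divr_gt0 e0 k0).
exists d => // n l r lr disj len.
apply: (@le_lt_trans _ _ (\sum_(i < n) k * `|f (r i) - f (l i)|)).
  apply: ler_sum => i _; have [al [lri rb]] := lr i.
  by apply: lip; rewrite ?rb ?al (le_trans al, le_trans lri).
by rewrite -mulr_sumr mulrC -ltr_pdivlMr// fd.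
Qed.

(** For x >= y the difference is ln (1 + (x - y) / y) <= (x - y) / y. *)
Lemma ln_lipschitz (R : realType) (m x y : R) : 0 < m -> m <= x -> m <= y ->
  `|ln x - ln y| <= m^-1 * `|x - y|.
Proof.
move=> m0; wlog xy : x y / y <= x => [hw mx my|mx my].
  have [yx|/ltW yx] := leP y x; first exact: hw.
  by rewrite distrC [`|x - y|]distrC hw.
have y0 : 0 < y := lt_le_trans m0 my.
have x0 : 0 < x := lt_le_trans y0 xy.
rewrite (ger0_norm (_ : 0 <= x - y)) ?subr_ge0// ger0_norm; last first.
  by rewrite subr_ge0 ler_ln.
rewrite -ln_div//; have -> : x / y = 1 + (x - y) / y by field; rewrite gt_eqF.
apply: (@le_trans _ _ ((x - y) / y)).
  apply: le_ln1Dx; apply: (@lt_le_trans _ _ 0); first by rewrite ltrN10.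
  by rewrite divr_ge0 ?subr_ge0// ltW.
by rewrite mulrC ler_wpM2r ?subr_ge0// lef_pV2.
Qed.

(** * The inflation formula *)

Lemma ae_itv_nonempty (R : realType) (a b : R) (P : R -> Prop) : a < b ->
  {ae (@lebesgue_measure R), forall x, P x} -> exists2 x, a < x < b & P x.
Proof.
move=> ab [N [mN N0 PN]]; apply: contrapT => noP.
have abN : `]a, b[%classic `<=` N.
  move=> x /=; rewrite in_itv/= => axb; apply: PN => /= Px.
  by apply: noP; exists x.
have : (@lebesgue_measure R `]a, b[%classic <= lebesgue_measure N)%E.
  by apply: le_measure => //; rewrite inE.
rewrite [X in (_ <= X)%E]N0 lebesgue_measure_itv/= lte_fin ab -EFinB lee_fin.
by rewrite subr_le0 leNgt ab.
Qed.

Lemma subdivision_le (R : realType) (a b : R) n (s : nat -> R) i j :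
  subdivision a b n s -> (i <= j)%N -> (j <= n)%N -> s i <= s j.
Proof.
move=> [_ _ sS]; elim: j => [|j IHj]; first by rewrite leqn0 => /eqP ->.
rewrite leq_eqVlt => /predU1P[->//|ij] jn.
by rewrite (le_trans (IHj ij (ltnW jn)))// ltW// sS.
Qed.

Theorem mainTheorem1 (R : realType) (t0 tn : R) (CPI X infl : R -> R)
  (lt_t0tn : t0 < tn)
  (CPI_gt0 : forall t, t0 <= t <= tn -> 0 < CPI t)
  (CPI_int : (@lebesgue_measure R).-integrable `[t0, tn] (EFin \o CPI))
  (CPI_diff : {ae (@lebesgue_measure R),
                 forall t, t0 < t < tn -> derivable CPI t 1})
  (CPI_ac : absolutely_continuous t0 tn CPI)
  (X_obj : objective_function `[t0, tn] CPI X)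
  (infl_rate : inflation_rate `]t0, tn[ CPI infl)
  (infl_int : (@lebesgue_measure R).-integrable `[t0, tn] (EFin \o infl)) :
  [/\ (@lebesgue_measure R).-integrable `[t0, tn]
        (EFin \o (fun u => ln (1 + infl u))),
      interval_inflation CPI t0 tn = X t0 / X tn - 1,
      X t0 / X tn - 1
        = expR (\int[@lebesgue_measure R]_(u in `[t0, tn]) ln (1 + infl u)) - 1
    & forall (n : nat) (s I : nat -> R),
        subdivision t0 tn n s -> piecewise_constant n s I infl ->
        expR (\int[@lebesgue_measure R]_(u in `[t0, tn]) ln (1 + infl u))
          = \prod_(i < n) (I i + 1) `^ (s i.+1 - s i)
        /\ X t0 / X tn = \prod_(i < n) (I i + 1) `^ (s i.+1 - s i)].
Proof.
pose f := @ln R \o CPI.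
have cpi0 : 0 < CPI t0 by rewrite CPI_gt0// lexx ltW.
have cpin : 0 < CPI tn by rewrite CPI_gt0// lexx ltW.
(* CPI attains a positive minimum, above which ln is Lipschitz. *)
have f_ac : absolutely_continuous t0 tn f.
  have [c c_itv minc] := EVT_min (ltW lt_t0tn)
    (absolutely_continuous_continuous CPI_ac).
  have m0 : 0 < CPI c by apply: CPI_gt0; rewrite in_itv/= in c_itv.
  apply: (@absolutely_continuous_lipschitz_comp _ _ _ (CPI c)^-1) => //.
    by rewrite invr_gt0.
  move=> x y xitv yitv.
  by apply: ln_lipschitz => //; apply: minc; rewrite in_itv.
(* The inflation rate is designed so that ln (1 + infl) is the logarithmic
   derivative of CPI. *)
have rate t : t0 < t < tn -> derivable CPI t 1 ->
    1 + infl t = expR ((CPI t)^-1 * 'D_1 CPI t).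
  by move=> titv dt; rewrite infl_rate ?in_itv//= derive1E addrC subrK mulrC.
have f_deriv : {ae (@lebesgue_measure R),
    forall t, t0 < t < tn -> is_derive t 1 f (ln (1 + infl t))}.
  move: CPI_diff.
  apply: (@filterS _ _ (ae_filter_ringOfSetsType (@lebesgue_measure R)))
    => t dt titv.
  rewrite rate ?expRK//; last exact: dt.
  apply: is_derive1_comp; last exact/derivableP/dt.
  by apply: is_derive1_ln; have /andP[tt0 ttn] := titv; rewrite CPI_gt0// !ltW.
have mlog : measurable_fun `]t0, tn[ (fun u => ln (1 + infl u)).
  apply: measurableT_comp; first exact: measurable_ln.
  apply: measurable_funD => //.
  apply/measurable_EFinP; apply: (measurable_int (@lebesgue_measure R)).
  by apply: integrableS infl_int => //; apply: subset_itv; rewrite bnd_simp.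
have [log_int logE] := absolutely_continuous_FTC lt_t0tn f_ac mlog f_deriv.
have XE : X t0 / X tn = CPI tn / CPI t0.
  have [c c0 Xc] := X_obj.
  rewrite !Xc /= ?in_itv/= ?lexx ?ltW//.
  by field; rewrite !gt_eqF.
have XexpE : X t0 / X tn =
    expR (\int[@lebesgue_measure R]_(u in `[t0, tn]) ln (1 + infl u)).
  by rewrite logE XE /f/= -ln_div// lnK// posrE divr_gt0.
split=> //; rewrite ?XE -?XE ?XexpE//.
  by rewrite /interval_inflation -XE XexpE.
move=> n s I sub pc.
have [s0 sn sS] := sub.
suff -> : expR (\int[@lebesgue_measure R]_(u in `[t0, tn]) ln (1 + infl u)) =
    \prod_(i < n) (I i + 1) `^ (s i.+1 - s i) by [].
have [i lin|i lin u siu|] := @integral_step R n s (fun i => ln (I i + 1))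
  (fun u => ln (1 + infl u)).
- exact/ltW/sS.
- by rewrite (pc i lin u siu) addrC.
rewrite s0 sn => _ ->; rewrite expR_sum; apply: eq_bigr => i _.
(* A point of differentiability inside the cell shows that I i + 1 is a value
   of expR, so that the power is the expected exponential. *)
have [t sit [t_itv dt]] : exists2 t, s i < t < s i.+1 &
    t0 < t < tn /\ derivable CPI t 1.
  have [t sit dt] := ae_itv_nonempty (sS i (ltn_ord i)) CPI_diff.
  have t_itv : t0 < t < tn.
    have /andP[sit1 sit2] := sit; rewrite -s0 -sn.
    rewrite (le_lt_trans (subdivision_le sub (leq0n i) (ltnW (ltn_ord i))))//.
    by rewrite (lt_le_trans sit2)// (subdivision_le sub).
  by exists t => //; split=> //; exact: dt.
have Igt0 : 0 < I i + 1.
  by rewrite addrC -(pc i (ltn_ord i) t sit) rate// expR_gt0.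
by rewrite /powR gt_eqF// mulrC.
Qed.
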